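(* Let $G$ be a graph on $n$ vertices and $A\in\mathcal{S}(G)$ a matrix with the SSP (respectively, the SMP). Then for every integer $q'$ with $q(A)\le q'\le n$ there is a matrix $A'\in\mathcal{S}(G)$ with the SSP (respectively, the SMP) such that $q(A')=q'$.
   Context: For a graph $G$ on vertex set $\{1,\ldots,n\}$, $\mathcal{S}(G)$ is the set of real symmetric $n\times n$ matrices whose $(i,j)$-entry for $i\neq j$ is nonzero if and only if $\{i,j\}$ is an edge (diagonal entries arbitrary). $q(A)$ is the number of distinct eigenvalues of $A$. $\circ$ is the entrywise product and $[A,X]=AX-XA$. A symmetric matrix $A$ with $q$ distinct eigenvalues has the SSP if $X=O$ is the only real symmetric matrix with $A\circ X=O$, $I\circ X=O$, $[A,X]=O$; it has the SMP if $X=O$ is the only real symmetric matrix with these three conditions and additionally $\operatorname{tr}(A^kX)=0$ for $k=0,\ldots,q-1$. *)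

(* Defs.v *)
From Stdlib Require Import Rdefinitions.
From mathcomp Require Import all_boot all_algebra.
From mathcomp Require Import Rstruct.
From mathcomp Require Import polyrcf.

Set Implicit Arguments.
Unset Strict Implicit.
Unset Printing Implicit Defensive.
Import GRing.Theory.
Local Open Scope ring_scope.

Definition simple_graph (n : nat) (G : rel 'I_n) : Prop :=
  (forall i j, G i j = G j i) /\ (forall i, G i i = false).

Definition in_SG (n : nat) (G : rel 'I_n) (A : 'M[R]_n) : Prop :=
  A^T = A /\ (forall i j : 'I_n, i != j -> (A i j != 0) = G i j).

(* q(A): number of distinct (real) eigenvalues, i.e. of distinct real roots
   of the characteristic polynomial (rootsR lists them without repetition). *)
Definition qA (n : nat) (A : 'M[R]_n) : nat := size (rootsR (char_poly A)).

Definition SSP (n : nat) (A : 'M[R]_n) : Prop :=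
  forall X : 'M[R]_n, X^T = X ->
    (forall i j, A i j * X i j = 0) ->
    (forall i, X i i = 0) ->
    A *m X = X *m A ->
    X = 0.

Definition SMP (n : nat) (A : 'M[R]_n) : Prop :=
  forall X : 'M[R]_n, X^T = X ->
    (forall i j, A i j * X i j = 0) ->
    (forall i, X i i = 0) ->
    A *m X = X *m A ->
    (forall k : nat, (k < qA A)%N -> \tr (A ^+ k *m X) = 0) ->
    X = 0.

(* Main.v *)
(** Let P project symmetric matrices onto the non-edges of G. For M symmetric and
    close to A, minimise
      |P N| + c (|L - M| + |a|),   L = Q M Q^T,   N = L + sum_(k < m) a_k L^k,
    over Q orthogonal and a small, with |.| the Frobenius norm. Suppose
    X = P N <> 0 at a minimiser. Rotating along K = -[N, X] (a Cayley transform)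
    changes |P N| at rate -2 |[N, X]|^2 / |X|, and moving a_k at rate
    tr(L^k X) / |X|, so minimality forces [N, X] and the tr(L^k X) to be
    O(c |X|). The SSP (m = 0) or the SMP (m = q(A)) says that these quantities
    are bounded below by a multiple of |X| at A, hence near A, so that X = 0 for
    c small. Thus N has the pattern of G. Since x + sum a_k x^k is injective on
    the spectrum of M for a small, N has as many distinct eigenvalues as M, and M
    can be chosen with any admissible number of them by splitting eigenvalues
    of A. The property persists at N by the same lower bound. *)

Require Import Defs.
From Stdlib Require Import Rdefinitions.
From mathcomp Require Import all_boot all_order all_algebra.
From mathcomp Require Import all_classical all_reals topology normedtype derive realfun.
From mathcomp Require Import Rstruct polyrcf ring lra.
Import Order.TTheory GRing.Theory Num.Theory numFieldNormedType.Exports.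
Set Implicit Arguments.
Unset Strict Implicit.
Unset Printing Implicit Defensive.
Local Open Scope ring_scope.
Local Open Scope classical_set_scope.

(** * The Frobenius norm *)

Definition dotm {R : realType} {m n} (A B : 'M[R]_(m, n)) : R := \tr (A^T *m B).

Definition fnorm {R : realType} {m n} (A : 'M[R]_(m, n)) : R := Num.sqrt (dotm A A).

Lemma dotmE {R : realType} m n (A B : 'M[R]_(m, n)) :
  dotm A B = \sum_i \sum_j A i j * B i j.
Proof.
rewrite /dotm /mxtrace exchange_big /=; apply: eq_bigr => j _.
by rewrite mxE; apply: eq_bigr => i _; rewrite mxE.
Qed.

Lemma dotmC {R : realType} m n (A B : 'M[R]_(m, n)) : dotm A B = dotm B A.
Proof. by rewrite /dotm -mxtrace_tr trmx_mul trmxK. Qed.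

Lemma dotmDr {R : realType} m n (A B C : 'M[R]_(m, n)) :
  dotm A (B + C) = dotm A B + dotm A C.
Proof. by rewrite /dotm mulmxDr raddfD. Qed.

Lemma dotmZr {R : realType} m n a (A B : 'M[R]_(m, n)) :
  dotm A (a *: B) = a * dotm A B.
Proof. by rewrite /dotm -scalemxAr linearZ. Qed.

Lemma dotmNr {R : realType} m n (A B : 'M[R]_(m, n)) : dotm A (- B) = - dotm A B.
Proof. by rewrite /dotm mulmxN raddfN. Qed.

Lemma dotmDl {R : realType} m n (A B C : 'M[R]_(m, n)) :
  dotm (B + C) A = dotm B A + dotm C A.
Proof. by rewrite !(dotmC _ A) dotmDr. Qed.

Lemma dotmZl {R : realType} m n a (A B : 'M[R]_(m, n)) :
  dotm (a *: B) A = a * dotm B A.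
Proof. by rewrite !(dotmC _ A) dotmZr. Qed.

Lemma dotmNl {R : realType} m n (A B : 'M[R]_(m, n)) : dotm (- B) A = - dotm B A.
Proof. by rewrite !(dotmC _ A) dotmNr. Qed.

Lemma dotm_ge0 {R : realType} m n (A : 'M[R]_(m, n)) : 0 <= dotm A A.
Proof.
rewrite dotmE; apply: sumr_ge0 => i _; apply: sumr_ge0 => j _.
by rewrite -expr2 sqr_ge0.
Qed.

Lemma sqr_entry_le {R : realType} m n (A : 'M[R]_(m, n)) i j :
  A i j ^+ 2 <= dotm A A.
Proof.
rewrite dotmE (bigD1 i) //= (bigD1 j) //= -expr2 -addrA lerDl addr_ge0 //.
  by apply: sumr_ge0 => k _; rewrite -expr2 sqr_ge0.
by apply: sumr_ge0 => k _; apply: sumr_ge0 => l _; rewrite -expr2 sqr_ge0.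
Qed.

Lemma fnorm_ge0 {R : realType} m n (A : 'M[R]_(m, n)) : 0 <= fnorm A.
Proof. exact: sqrtr_ge0. Qed.

Lemma sqr_fnorm {R : realType} m n (A : 'M[R]_(m, n)) : fnorm A ^+ 2 = dotm A A.
Proof. by rewrite sqr_sqrtr // dotm_ge0. Qed.

Lemma entry_le_fnorm {R : realType} m n (A : 'M[R]_(m, n)) i j :
  `|A i j| <= fnorm A.
Proof. by rewrite -sqrtr_sqr ler_wsqrtr // sqr_entry_le. Qed.

Lemma fnorm0 {R : realType} m n : fnorm (0 : 'M[R]_(m, n)) = 0.
Proof. by rewrite /fnorm /dotm mulmx0 mxtrace0 sqrtr0. Qed.

Lemma fnorm_eq0 {R : realType} m n (A : 'M[R]_(m, n)) : (fnorm A == 0) = (A == 0).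
Proof.
apply/eqP/eqP => [A0|->]; last exact: fnorm0.
apply/matrixP => i j; rewrite mxE; apply/eqP; rewrite -normr_le0 -A0.
exact: entry_le_fnorm.
Qed.

Lemma fnormZ {R : realType} m n a (A : 'M[R]_(m, n)) :
  fnorm (a *: A) = `|a| * fnorm A.
Proof.
by rewrite /fnorm dotmZl dotmZr mulrA -expr2 sqrtrM ?sqr_ge0 // sqrtr_sqr.
Qed.

Lemma fnormN {R : realType} m n (A : 'M[R]_(m, n)) : fnorm (- A) = fnorm A.
Proof. by rewrite /fnorm dotmNl dotmNr opprK. Qed.

Lemma sqr_dotm_le {R : realType} m n (A B : 'M[R]_(m, n)) :
  dotm A B ^+ 2 <= dotm A A * dotm B B.
Proof.
have [/eqP B0|B0] := eqVneq (dotm B B) 0.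
  have -> : B = 0 by apply/eqP; rewrite -fnorm_eq0 /fnorm (eqP B0) sqrtr0.
  by rewrite /dotm !mulmx0 mxtrace0 mulr0 expr0n.
have Bp : 0 < dotm B B by rewrite lt_def B0 dotm_ge0.
(* In the notation set below, this square expands to [b * (a * b - c ^+ 2)], and [b] is positive. *)
have := dotm_ge0 (dotm B B *: A - dotm A B *: B).
rewrite !(dotmDl, dotmDr, dotmNl, dotmNr, dotmZl, dotmZr) (dotmC B A).
set a := dotm A A; set b := dotm B B in B0 Bp *; set c := dotm A B => H.
rewrite -subr_ge0 -(pmulr_rge0 _ Bp); apply: le_trans H _.
by rewrite le_eqVlt; apply/orP; left; apply/eqP; ring.
Qed.

Lemma dotm_le {R : realType} m n (A B : 'M[R]_(m, n)) :
  `|dotm A B| <= fnorm A * fnorm B.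
Proof.
by rewrite -sqrtrM ?dotm_ge0 // -sqrtr_sqr ler_wsqrtr // sqr_dotm_le.
Qed.

Lemma fnormD {R : realType} m n (A B : 'M[R]_(m, n)) :
  fnorm (A + B) <= fnorm A + fnorm B.
Proof.
rewrite -(@ler_pXn2r _ 2) ?nnegrE ?addr_ge0 ?fnorm_ge0 //.
rewrite sqr_fnorm !(dotmDl, dotmDr) sqrrD !sqr_fnorm (dotmC B A).
have := le_trans (ler_norm _) (dotm_le A B); lra.
Qed.

Lemma fnormB {R : realType} m n (A B : 'M[R]_(m, n)) :
  fnorm (A - B) <= fnorm A + fnorm B.
Proof. by rewrite -(fnormN B) fnormD. Qed.

Lemma fnorm_sum {R : realType} m n (I : Type) (r : seq I) (F : I -> 'M[R]_(m, n)) :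
  fnorm (\sum_(i <- r) F i) <= \sum_(i <- r) fnorm (F i).
Proof.
elim/big_ind2: _ => // [|x1 x2 y1 y2 h1 h2]; first by rewrite fnorm0.
by apply: le_trans (fnormD _ _) _; apply: lerD.
Qed.

Lemma fnormM {R : realType} m n p (A : 'M[R]_(m, n)) (B : 'M[R]_(n, p)) :
  fnorm (A *m B) <= fnorm A * fnorm B.
Proof.
rewrite -sqrtrM ?dotm_ge0 // ler_wsqrtr //.
rewrite !dotmE mulr_suml; apply: ler_sum => i _.
rewrite exchange_big mulr_sumr /=; apply: ler_sum => j _.
(* Cauchy-Schwarz for row [i] of [A] and column [j] of [B] bounds one entry of the product. *)
have := sqr_dotm_le (\row_k A i k) (\row_k B k j).
rewrite !dotmE !big_ord1 [(A *m B) i j]mxE -expr2.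
have E p' (f g : 'I_p' -> R) : \sum_k (\row_k f k) ord0 k * (\row_k g k) ord0 k
    = \sum_k f k * g k by apply: eq_bigr => k _; rewrite !mxE.
by rewrite !E.
Qed.

Lemma fnorm_tr {R : realType} m n (A : 'M[R]_(m, n)) : fnorm A^T = fnorm A.
Proof. by rewrite /fnorm /dotm trmxK mxtrace_mulC. Qed.

Lemma fnorm_orthl {R : realType} m n (Q : 'M[R]_m) (A : 'M[R]_(m, n)) :
  Q *m Q^T = 1%:M -> fnorm (Q *m A) = fnorm A.
Proof.
move=> /mulmx1C QQ.
by rewrite /fnorm /dotm trmx_mul -mulmxA (mulmxA Q^T) QQ mul1mx.
Qed.

Lemma fnorm_conj {R : realType} n (Q A : 'M[R]_n) :
  Q *m Q^T = 1%:M -> fnorm (Q *m A *m Q^T) = fnorm A.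
Proof.
move=> QQ; rewrite -mulmxA fnorm_orthl //.
by rewrite -fnorm_tr trmx_mul trmxK fnorm_orthl // fnorm_tr.
Qed.

Lemma trM_le {R : realType} n (A B : 'M[R]_n) :
  `|\tr (A *m B)| <= fnorm A * fnorm B.
Proof. by have := dotm_le A^T B; rewrite /dotm trmxK fnorm_tr. Qed.

(** * Continuity and compactness for matrices *)

(** Testing entries reduces products, powers and traces of matrices to sums and products of real
    functions. *)
Definition entrywise_continuous {R : realType} {T : topologicalType} {m n}
  (F : T -> 'M[R]_(m, n)) := forall i j, continuous (fun x => F x i j).

Lemma continuous_sumr {R : realType} {T : topologicalType} (I : Type)
    (r : seq I) (F : I -> T -> R) :
  (forall i, continuous (F i)) -> continuous (fun x => \sum_(i <- r) F i x).
Proof.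
move=> cF; elim: r => [|i r IH].
  under eq_fun do rewrite big_nil.
  exact: cst_continuous.
under eq_fun do rewrite big_cons.
move=> x; apply: (@continuousD _ _ _ (F i)); [exact: cF|exact: IH].
Qed.

Lemma entrywise_continuous_cst {R : realType} {T : topologicalType} m n
  (A : 'M[R]_(m, n)) : entrywise_continuous (fun _ : T => A).
Proof. by move=> i j; exact: cst_continuous. Qed.

Lemma entrywise_continuousD {R : realType} {T : topologicalType} m n
    (F G : T -> 'M[R]_(m, n)) :
  entrywise_continuous F -> entrywise_continuous G ->
  entrywise_continuous (fun x => F x + G x).
Proof.
move=> cF cG i j x; under eq_fun do rewrite mxE.
by apply: (@continuousD _ _ _ (fun x => F x i j)); [exact: cF|exact: cG].
Qed.

Lemma entrywise_continuousN {R : realType} {T : topologicalType} m n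
    (F : T -> 'M[R]_(m, n)) :
  entrywise_continuous F -> entrywise_continuous (fun x => - F x).
Proof.
move=> cF i j x; under eq_fun do rewrite mxE.
by apply: (@continuousN _ _ _ (fun x => F x i j)); exact: cF.
Qed.

Lemma entrywise_continuousB {R : realType} {T : topologicalType} m n
    (F G : T -> 'M[R]_(m, n)) :
  entrywise_continuous F -> entrywise_continuous G ->
  entrywise_continuous (fun x => F x - G x).
Proof.
by move=> cF cG; apply: entrywise_continuousD => //; apply: entrywise_continuousN.
Qed.

Lemma entrywise_continuousM {R : realType} {T : topologicalType} m n p
    (F : T -> 'M[R]_(m, n)) (G : T -> 'M[R]_(n, p)) :
  entrywise_continuous F -> entrywise_continuous G ->
  entrywise_continuous (fun x => F x *m G x).
Proof.
move=> cF cG i j; under eq_fun do rewrite mxE.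
apply: continuous_sumr => k x.
by apply: (@continuousM _ _ (fun x => F x i k)); [exact: cF|exact: cG].
Qed.

Lemma entrywise_continuousZ {R : realType} {T : topologicalType} m n
    (f : T -> R) (F : T -> 'M[R]_(m, n)) :
  continuous f -> entrywise_continuous F ->
  entrywise_continuous (fun x => f x *: F x).
Proof.
move=> cf cF i j x; under eq_fun do rewrite mxE.
by apply: (@continuousM _ _ f (fun x => F x i j)); [exact: cf|exact: cF].
Qed.

Lemma entrywise_continuousX {R : realType} {T : topologicalType} n k
    (F : T -> 'M[R]_n) :
  entrywise_continuous F -> entrywise_continuous (fun x => F x ^+ k).
Proof.
move=> cF; elim: k => [|k IH].
  under eq_fun do rewrite expr0.
  exact: entrywise_continuous_cst.
under eq_fun do rewrite exprS.
  exact: entrywise_continuousM.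
Qed.

Lemma entrywise_continuous_sum {R : realType} {T : topologicalType} m n
    (I : Type) (r : seq I) (F : I -> T -> 'M[R]_(m, n)) :
  (forall i, entrywise_continuous (F i)) ->
  entrywise_continuous (fun x => \sum_(i <- r) F i x).
Proof.
move=> cF; elim: r => [|i r IH].
  under eq_fun do rewrite big_nil.
  exact: entrywise_continuous_cst.
under eq_fun do rewrite big_cons.
  exact: entrywise_continuousD.
Qed.

Lemma entrywise_continuous_tr {R : realType} {T : topologicalType} m n
    (F : T -> 'M[R]_(m, n)) :
  entrywise_continuous F -> entrywise_continuous (fun x => (F x)^T).
move=> cF i j; under eq_fun do rewrite mxE.
exact: cF.
Qed.

Lemma continuous_mxtrace {R : realType} {T : topologicalType} n
    (F : T -> 'M[R]_n) :
  entrywise_continuous F -> continuous (fun x => \tr (F x)).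
Proof. by move=> cF; apply: continuous_sumr => i; exact: cF. Qed.

Lemma continuous_fnorm {R : realType} {T : topologicalType} m n
    (F : T -> 'M[R]_(m, n)) :
  entrywise_continuous F -> continuous (fun x => fnorm (F x)).
Proof.
move=> cF x; apply: (@continuous_comp _ _ _ (fun x => dotm (F x) (F x))).
  apply: (continuous_mxtrace (F := fun x => (F x)^T *m F x)).
  by apply: entrywise_continuousM => //; apply: entrywise_continuous_tr.
exact: sqrt_continuous.
Qed.

Lemma closed_eq0 {R : realType} {T : topologicalType} m n
    (F : T -> 'M[R]_(m, n)) :
  entrywise_continuous F -> closed [set x | F x = 0].
Proof.
move=> cF; have -> : [set x | F x = 0] = (fun x => fnorm (F x)) @^-1` [set 0].
  by apply/seteqP; split => x /= /eqP; [rewrite -fnorm_eq0|rewrite fnorm_eq0] => /eqP.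
apply: preimage_closed => [x _|]; first exact: continuous_fnorm.
exact: closed_eq.
Qed.

(** The norm bounds every entry, so [S] is a closed subset of the image under [vec_mx] of the cube
    [[-B, B]^(m n)]. The map [vec_mx] only rearranges coordinates and is therefore continuous. *)
Lemma compact_mx {R : realType} m n (B : R) (S : set 'M[R]_(m, n)) :
  (forall M, S M -> fnorm M <= B) -> closed S -> compact S.
Proof.
move=> SB cS.
pose K := [set v : 'rV[R]_(m * n) | forall i, `[- B, B] (v ord0 i)].
have cK : compact K.
  by apply: (@rV_compact _ _ (fun=> `[- B, B])) => i; exact: segment_compact.
have cv : continuous (fun v : 'rV[R]_(m * n) => vec_mx v).
  move=> v s /= /nbhs_ballP [e e0 es]; apply/nbhs_ballP; exists e => // w [_ vw].
  by apply: es; split => // i j; rewrite !mxE.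
have cvK : compact ((fun v : 'rV[R]_(m * n) => vec_mx v) @` K).
  by apply: continuous_compact => //; exact: continuous_subspaceT.
apply: subclosed_compact cvK _ => // M SM; exists (mxvec M); last exact: mxvecK.
move=> i; case/mxvec_indexP: i => i j; rewrite mxvecE /= in_itv /= -ler_norml.
exact: le_trans (entry_le_fnorm _ _ _) (SB _ SM).
Qed.

Lemma compact_attains_min {R : realType} {T : topologicalType} (S : set T) (f : T -> R) :
  compact S -> continuous f -> S !=set0 ->
  exists2 c, S c & forall x, S x -> f c <= f x.
Proof.
move=> cS cf S0.
have [c + cmin] := compact_EVT_min S0 cS (continuous_subspaceT cf).
by rewrite inE => Sc; exists c => // x Sx; apply: cmin; rewrite inE.
Qed.

Definition orthogonal_mx {R : realType} n : set 'M[R]_n :=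
  [set Q | Q *m Q^T = 1%:M].

Lemma entrywise_continuous_id {R : realType} m n :
  entrywise_continuous (fun M : 'M[R]_(m, n) => M).
Proof. by move=> i j; exact: coord_continuous. Qed.

Lemma compact_orthogonal_mx {R : realType} n : compact (@orthogonal_mx R n).
Proof.
apply: (@compact_mx _ _ _ (fnorm (1%:M : 'M[R]_n))) => [M QQ|].
  by rewrite -[M]mulmx1 fnorm_orthl.
have -> : @orthogonal_mx R n = [set Q | Q *m Q^T - 1%:M = 0].
  apply/seteqP; split => Q /=; first by move=> ->; rewrite subrr.
  by move=> /eqP; rewrite subr_eq0 => /eqP.
apply: closed_eq0; apply: entrywise_continuousB.
  apply: entrywise_continuousM; first exact: entrywise_continuous_id.
  apply: entrywise_continuous_tr; exact: entrywise_continuous_id.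
exact: entrywise_continuous_cst.
Qed.

(** * Orthogonal similarity to first order *)

Definition bracket {R : realType} {n} (A B : 'M[R]_n) : 'M[R]_n :=
  A *m B - B *m A.

Lemma bracketDl {R : realType} n (A B C : 'M[R]_n) :
  bracket (A + B) C = bracket A C + bracket B C.
Proof. by rewrite /bracket mulmxDl mulmxDr opprD addrACA. Qed.

Lemma bracketNl {R : realType} n (A B : 'M[R]_n) :
  bracket (- A) B = - bracket A B.
Proof. by rewrite /bracket mulNmx mulmxN opprB opprK addrC. Qed.

Lemma fnorm_bracket {R : realType} n (A B : 'M[R]_n) :
  fnorm (bracket A B) <= 2 * (fnorm A * fnorm B).
Proof.
apply: le_trans (fnormB _ _) _; have := fnormM A B; have := fnormM B A; lra.
Qed.

Lemma tr_bracket {R : realType} n (A B : 'M[R]_n) :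
  A^T = A -> B^T = B -> (bracket A B)^T = - bracket A B.
Proof. by move=> sA sB; rewrite /bracket linearB /= !trmx_mul sA sB opprB. Qed.

(** Invariance of the trace form. It rewrites the slope of a linear functional along a rotation as a
    pairing with a bracket, and so as a squared norm for a suitable direction. *)
Lemma trM_bracket {R : realType} n (A B C : 'M[R]_n) :
  \tr (A *m bracket B C) = \tr (bracket A B *m C).
Proof.
rewrite /bracket mulmxBr mulmxBl !linearB /= !mulmxA; congr (_ - _).
by rewrite mxtrace_mulC mulmxA.
Qed.

(* A skew K has v K v^T = 0, so v (1 + K) = 0 gives v v^T = 0. *)
Lemma skew_unitmx {R : realType} n (K : 'M[R]_n) :
  K^T = - K -> 1%:M + K \in unitmx.
Proof.
move=> sK; rewrite -row_free_unit; apply: inj_row_free => v.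
rewrite mulmxDr mulmx1 => vK.
have q0 : \tr (v *m K *m v^T) = 0.
  have : \tr (v *m K *m v^T) = - \tr (v *m K *m v^T).
    by rewrite -[LHS]mxtrace_tr !trmx_mul trmxK sK mulNmx mulmxN raddfN mulmxA.
  lra.
have : \tr ((v + v *m K) *m v^T) = 0 by rewrite vK mul0mx mxtrace0.
rewrite mulmxDl raddfD /= q0 addr0 mxtrace_mulC => v0.
by apply/eqP; rewrite -fnorm_eq0 -sqrf_eq0 sqr_fnorm /dotm v0.
Qed.

(* Cayley transform: Q = (1 + tK)^-1 (1 - tK). *)
Lemma orthogonal_near_id {R : realType} n (K : 'M[R]_n) (t : R) :
  K^T = - K -> 0 <= t <= 1 ->
  exists2 Q, orthogonal_mx Q & forall N,
    fnorm (Q *m N *m Q^T - N - (2 * t) *: bracket N K) <=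
    4 * (2 * fnorm K + fnorm K ^+ 2) ^+ 2 * fnorm N * t ^+ 2.
Proof.
move=> sK /andP[t0 t1].
set B := 1%:M + t *: K.
have Bu : B \in unitmx by apply: skew_unitmx; rewrite linearZ /= sK scalerN.
have BT : B^T = 1%:M - t *: K.
  by rewrite /B linearD /= linearZ /= trmx1 sK scalerN.
have BTu : B^T \in unitmx by rewrite unitmx_tr.
(* Both factors are polynomials in [K]; that they commute is what makes [Q] orthogonal. *)
have BC : B^T *m B = B *m B^T.
  rewrite BT /B !(mulmxDl, mulmxDr, mulmxBl, mulmxBr) !mul1mx !mulmx1.
  by rewrite !mulNmx !mulmxN !addrA; congr (_ - _); rewrite addrAC -!addrA;
    congr (_ + _); rewrite addrC.
pose Q := invmx B *m B^T.
have QT : Q^T = B *m invmx B^T by rewrite trmx_mul trmxK trmx_inv.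
have QQ : Q *m Q^T = 1%:M.
  by rewrite QT /Q -mulmxA (mulmxA B^T) BC -(mulmxA B) mulmxV // mulmx1 mulVmx.
exists Q => // N.
set N' := Q *m N *m Q^T.
have nN' : fnorm N' = fnorm N by exact: fnorm_conj.
have BN : B *m N' *m B^T = B^T *m N *m B.
  by rewrite /N' /Q QT !mulmxA mulmxV // mul1mx -!mulmxA mulVmx // mulmx1 !mulmxA.
set D := N' - N.
(* Expanding [BN] gives an implicit equation for the displacement [D]. The terms other than [2t
   [N, K]] carry a factor [t] and again contain [D], so they are of second order. *)
have DE : D = (2 * t) *: bracket N K + (t *: bracket D K + t ^+ 2 *: (K *m D *m K)).
  move: BN; rewrite BT /B /D /bracket !(mulmxDl, mulmxDr, mulNmx, mulmxN).
  rewrite !(mul1mx, mulmx1) -!(scalemxAl, scalemxAr).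
  move: (K *m N) (N *m K) (K *m N') (N' *m K) (K *m N *m K) (K *m N' *m K).
  move=> X1 X2 X3 X4 X5 X6 /matrixP E; apply/matrixP => i j.
  by have := E i j; rewrite !mxE => {}E; lra.
rewrite -/D; have -> : D - (2 * t) *: bracket N K =
   t *: bracket D K + t ^+ 2 *: (K *m D *m K) by rewrite {1}DE addrC addKr.
set k := fnorm K; set v := fnorm N.
have [k0 v0] : 0 <= k /\ 0 <= v by split; exact: fnorm_ge0.
have KDK : fnorm (K *m D *m K) <= k ^+ 2 * fnorm D.
  apply: le_trans (fnormM _ _) _; rewrite -/k expr2 mulrC -mulrA ler_wpM2l //.
  exact: fnormM.
have D2 : fnorm D <= 2 * v by apply: le_trans (fnormB _ _) _; rewrite nN' -/v; lra.
have tE (X Y : 'M[R]_n) : fnorm (t *: X + t ^+ 2 *: Y) <= t * fnorm X + t ^+ 2 * fnorm Y.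
  by apply: le_trans (fnormD _ _) _; rewrite !fnormZ !ger0_norm // sqr_ge0.
(* Bootstrap: the crude bound [D2] put into [DE] makes [D] of order [t]; putting that into [DE] once
   more makes the remainder of order [t ^+ 2]. *)
have Dt : fnorm D <= t * (4 * (2 * k + k ^+ 2) * v).
  rewrite DE; apply: le_trans (fnormD _ _) _.
  have := tE (bracket D K) (K *m D *m K); have := fnorm_bracket D K.
  have := fnorm_bracket N K; rewrite fnormZ -/k -/v ger0_norm ?mulr_ge0 //.
  have k20 := sqr_ge0 k; have kv := mulr_ge0 k0 v0.
  have tD : t * fnorm (bracket D K) <= t * (2 * (2 * v * k)).
    by rewrite ler_wpM2l //; apply: le_trans (fnorm_bracket _ _) _; rewrite -/k; nra.
  have tN : t * fnorm (bracket N K) <= t * (2 * (v * k)).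
    by rewrite ler_wpM2l //; exact: fnorm_bracket.
  have ttK : t ^+ 2 * fnorm (K *m D *m K) <= t * (k ^+ 2 * (2 * v)).
    rewrite expr2 -mulrA ler_wpM2l //; apply: le_trans (_ : 1 * (k ^+ 2 * (2 * v)) <= _).
      apply: ler_pM => //; first exact: fnorm_ge0.
      by apply: le_trans KDK _; rewrite ler_wpM2l.
    by rewrite mul1r.
  have := mulr_ge0 t0 (mulr_ge0 k20 v0); nra.
apply: le_trans (tE _ _) _; have := fnorm_bracket D K; rewrite -/k => bD.
have E1 : t * fnorm (bracket D K) <= t * (2 * k * fnorm D).
  by rewrite ler_wpM2l //; lra.
have E2 : t ^+ 2 * fnorm (K *m D *m K) <= t * (k ^+ 2 * fnorm D).
  rewrite expr2 -mulrA ler_wpM2l //; apply: le_trans (_ : 1 * (k ^+ 2 * fnorm D) <= _).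
    by apply: ler_pM => //; exact: fnorm_ge0.
  by rewrite mul1r.
have E3 : t * ((2 * k + k ^+ 2) * fnorm D) <=
    t * ((2 * k + k ^+ 2) * (t * (4 * (2 * k + k ^+ 2) * v))).
  by rewrite ler_wpM2l // ler_wpM2l // addr_ge0 ?sqr_ge0 // mulr_ge0.
lra.
Qed.

(** Divide by [t] and let [t] tend to 0. This stands in for the sign of a one-sided derivative at a
    minimum. *)
Lemma first_order_ge0 {R : realType} (s C : R) :
  (forall t : R, 0 < t <= 1 -> 0 <= t * s + C * t ^+ 2) -> 0 <= s.
Proof.
move=> H; rewrite leNgt; apply/negP => s0.
have C1 : 0 < 2 * (`|C| + 1) by rewrite mulr_gt0 // ltr_pwDr // normr_ge0.
(* With this choice [2 (|C| + 1) t <= - s], whence [s + C t < 0]. *)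
pose t := Num.min 1 (- s / (2 * (`|C| + 1))).
have t0 : 0 < t by rewrite lt_min ltr01 divr_gt0 // oppr_gt0.
have t1 : t <= 1 by rewrite ge_min lexx.
have : t <= - s / (2 * (`|C| + 1)) by rewrite ge_min lexx orbT.
rewrite ler_pdivlMr // => ts.
have := H t; rewrite t0 t1 => /(_ isT); apply/negP; rewrite -ltNge.
rewrite expr2 mulrCA -mulrDr pmulr_rlt0 //.
have := ler_norm C; have := normr_ge0 C; nra.
Qed.

(* The weights 0, ..., n - 1 being distinct, a maximiser N of tr(W N) in the
   orbit of A commutes with W = diag(0, ..., n - 1) and is thus diagonal. *)
Lemma symmetric_diagonalisation {R : realType} n (A : 'M[R]_n) : A^T = A ->
  exists U d, orthogonal_mx U /\ A = U *m diag_mx d *m U^T.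
Proof.
move=> sA.
pose w : 'rV[R]_n := \row_i (i : nat)%:R.
pose W := diag_mx w.
have sW : W^T = W by rewrite tr_diag_mx.
have [Q QQ Qmax] : exists2 Q, @orthogonal_mx R n Q &
    forall P, orthogonal_mx P -> - \tr (W *m (Q *m A *m Q^T)) <= - \tr (W *m (P *m A *m P^T)).
  apply: (compact_attains_min (S := @orthogonal_mx R n)
    (f := fun Q : 'M[R]_n => - \tr (W *m (Q *m A *m Q^T)))).
  - exact: compact_orthogonal_mx.
  - move=> x; apply: (@continuousN _ _ _ (fun Q : 'M[R]_n => \tr (W *m (Q *m A *m Q^T)))).
    apply: (continuous_mxtrace (F := fun Q : 'M[R]_n => W *m (Q *m A *m Q^T))).
    apply: entrywise_continuousM; first exact: entrywise_continuous_cst.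
    apply: entrywise_continuousM.
      apply: entrywise_continuousM; last exact: entrywise_continuous_cst.
      exact: entrywise_continuous_id.
    apply: entrywise_continuous_tr; exact: entrywise_continuous_id.
  - by exists 1%:M; rewrite /orthogonal_mx /= trmx1 mulmx1.
set N := Q *m A *m Q^T in Qmax *.
have sN : N^T = N by rewrite /N !trmx_mul trmxK sA mulmxA.
pose Y := bracket W N.
have sY : Y^T = - Y by exact: tr_bracket.
have sYN : (- Y)^T = - - Y by rewrite linearN /= sY.
(* Rotating along [- Y] changes [tr(W N)] at rate [- 2 tr(Y Y)], which is [2 |Y|^2] since [Y] is
   skew. Maximality then leaves only [Y = 0]. *)
have Y0 : 0 <= - (2 * fnorm Y ^+ 2).
  apply: (@first_order_ge0 _ _ (fnorm W *
     (4 * (2 * fnorm (- Y) + fnorm (- Y) ^+ 2) ^+ 2 * fnorm N))) => t /andP[t0 t1].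
  have [|P PP /(_ N)] := @orthogonal_near_id _ _ _ t sYN; first by rewrite (ltW t0).
  set E := _ - _ => EN.
  have PQ : orthogonal_mx (P *m Q).
    by rewrite /orthogonal_mx /= trmx_mul mulmxA -(mulmxA P) QQ mulmx1.
  have := Qmax _ PQ; rewrite trmx_mul -(mulmxA P).
  have -> : P *m (Q *m A) *m (Q^T *m P^T) = N + (2 * t) *: bracket N (- Y) + E.
    by rewrite /E -[X in _ + X]addrA -opprD [RHS]addrC subrK /N !mulmxA.
  clearbody E; rewrite !mulmxDr !mxtraceD -scalemxAr mxtraceZ trM_bracket -/Y mulmxN raddfN /=.
  have -> : \tr (Y *m Y) = - fnorm Y ^+ 2.
    by rewrite sqr_fnorm /dotm sY mulNmx raddfN opprK.
  have := trM_le W E; rewrite ler_norml => /andP[+ _].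
  have := ler_wpM2l (fnorm_ge0 W) EN; lra.
have {}Y0 : Y = 0.
  apply/eqP; rewrite -fnorm_eq0 -sqrf_eq0; apply/eqP.
  have := sqr_ge0 (fnorm Y); lra.
exists Q^T, (\row_i N i i); split.
  by rewrite /orthogonal_mx /= trmxK; exact: mulmx1C.
have -> : diag_mx (\row_i N i i) = N.
  have YE i j : Y i j = ((i : nat)%:R - (j : nat)%:R) * N i j.
    by rewrite /Y /bracket /W mul_diag_mx mul_mx_diag; move: (N) => M;
      rewrite !mxE mulrBl (mulrC (M i j)).
  apply/matrixP => i j; move: (YE i j); rewrite Y0; move: (N) => M.
  rewrite !mxE; have [->|ij] := eqVneq i j; first by rewrite mulr1n.
  move=> /esym/eqP; rewrite mulr0n mulf_eq0 => /orP[|/eqP->//].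
  by rewrite subr_eq0 eqr_nat => /eqP ij'; case/eqP: ij; apply/val_inj.
by rewrite trmxK /N !mulmxA (mulmx1C QQ) mul1mx -mulmxA (mulmx1C QQ) mulmx1.
Qed.

(** * Transversality and the penalised minimisation *)

(** The orthogonal projection for [dotm] onto the matrices vanishing on the diagonal and on the
    edges. *)
Definition nonedge_proj {R : realType} {n} (G : rel 'I_n) (N : 'M[R]_n) : 'M[R]_n :=
  \matrix_(i, j) if (i == j) || G i j then 0 else N i j.

(** A common form of both properties: [m = 0] is the SSP and [m = qA A] the SMP. Keeping [m]
    independent of [A] lets the property pass to a nearby matrix with more eigenvalues. *)
Definition transversal {R : realType} {n} (G : rel 'I_n) (m : nat) (A : 'M[R]_n) :=
  forall X : 'M[R]_n, X^T = X -> nonedge_proj G X = X -> bracket A X = 0 ->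
  (forall k : 'I_m, \tr (A ^+ k *m X) = 0) -> X = 0.

(** The bracket involves [N] and the powers involve [L] because these are the slopes that rotations
    and changes of coefficients produce in the minimisation. *)
Definition defect {R : realType} {n} m (N L X : 'M[R]_n) : R :=
  fnorm (bracket N X) + \sum_(k < m) `|\tr (L ^+ k *m X)|.

(** A polynomial in [L]: eigenvectors of [L] remain eigenvectors, and the derivative in the
    coefficient [a 0 k] is [L ^+ k], the matrix of a trace condition. *)
Definition perturb {R : realType} {n m} (a : 'rV[R]_m) (L : 'M[R]_n) : 'M[R]_n :=
  L + \sum_(k < m) a 0 k *: L ^+ k.

Lemma expmxS {R : realType} n (A : 'M[R]_n) k : A ^+ k.+1 = A *m A ^+ k.
Proof. exact: exprS. Qed.

Lemma nonedge_projD {R : realType} n (G : rel 'I_n) (M N : 'M[R]_n) :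
  nonedge_proj G (M + N) = nonedge_proj G M + nonedge_proj G N.
Proof. by apply/matrixP => i j; rewrite !mxE; case: ifP; rewrite ?addr0. Qed.

Lemma nonedge_projZ {R : realType} n (G : rel 'I_n) a (M : 'M[R]_n) :
  nonedge_proj G (a *: M) = a *: nonedge_proj G M.
Proof. by apply/matrixP => i j; rewrite !mxE; case: ifP; rewrite ?mulr0. Qed.

Lemma nonedge_proj_id {R : realType} n (G : rel 'I_n) (M : 'M[R]_n) :
  nonedge_proj G (nonedge_proj G M) = nonedge_proj G M.
Proof. by apply/matrixP => i j; rewrite !mxE; case: (_ || _). Qed.

Lemma tr_nonedge_proj {R : realType} n (G : rel 'I_n) (M : 'M[R]_n) :
  (forall i j, G i j = G j i) -> M^T = M ->
  (nonedge_proj G M)^T = nonedge_proj G M.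
Proof.
move=> sG sM; apply/matrixP => i j.
by rewrite !mxE eq_sym sG -{1}sM mxE.
Qed.

Lemma dotm_nonedge_proj {R : realType} n (G : rel 'I_n) (M N : 'M[R]_n) :
  dotm (nonedge_proj G M) (nonedge_proj G N) = dotm (nonedge_proj G M) N.
Proof.
rewrite !dotmE; apply: eq_bigr => i _; apply: eq_bigr => j _.
by rewrite !mxE; case: ifP; rewrite ?mul0r.
Qed.

Lemma fnorm_nonedge_proj {R : realType} n (G : rel 'I_n) (M : 'M[R]_n) :
  fnorm (nonedge_proj G M) <= fnorm M.
Proof.
rewrite ler_wsqrtr // !dotmE; apply: ler_sum => i _; apply: ler_sum => j _.
by rewrite mxE; case: ifP; rewrite ?mul0r // -expr2 sqr_ge0.
Qed.

Lemma entrywise_continuous_nonedge_proj {R : realType} {T : topologicalType} n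
    (G : rel 'I_n) (F : T -> 'M[R]_n) :
  entrywise_continuous F -> entrywise_continuous (fun x => nonedge_proj G (F x)).
Proof.
move=> cF i j; under eq_fun do rewrite mxE.
by case: (_ || _); [exact: cst_continuous|exact: cF].
Qed.

Lemma continuous_defect {R : realType} n m (A : 'M[R]_n) : continuous (defect m A A).
Proof.
have cid := @entrywise_continuous_id R n n.
have cM (M : 'M[R]_n) : entrywise_continuous (fun X : 'M[R]_n => M *m X).
  exact: (entrywise_continuousM (@entrywise_continuous_cst R 'M[R]_n n n M) cid).
have cM' (M : 'M[R]_n) : entrywise_continuous (fun X : 'M[R]_n => X *m M).
  exact: (entrywise_continuousM cid (@entrywise_continuous_cst R 'M[R]_n n n M)).
move=> x; apply: (@continuousD _ _ _ (fun X : 'M[R]_n => fnorm (bracket A X))).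
  apply: (continuous_fnorm (F := fun X : 'M[R]_n => bracket A X)).
  exact: (entrywise_continuousB (cM A) (cM' A)).
apply: (@continuous_sumr _ _ _ _ (fun (k : 'I_m) (X : 'M[R]_n) => `|\tr (A ^+ k *m X)|)).
move=> k y; apply: (@continuous_comp _ _ _ (fun X : 'M[R]_n => \tr (A ^+ k *m X))).
  exact: (continuous_mxtrace (F := fun X : 'M[R]_n => A ^+ k *m X)).
exact: norm_continuous.
Qed.

Lemma defect_ge0 {R : realType} n m (N L X : 'M[R]_n) : 0 <= defect m N L X.
Proof. by rewrite addr_ge0 ?fnorm_ge0 ?sumr_ge0. Qed.

Lemma defectZ {R : realType} n m a (N L X : 'M[R]_n) :
  defect m N L (a *: X) = `|a| * defect m N L X.
Proof.
rewrite /defect /bracket -scalemxAr -scalemxAl -scalerBr fnormZ mulrDr; congr (_ + _).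
by rewrite mulr_sumr; apply: eq_bigr => k _; rewrite -scalemxAr mxtraceZ normrM.
Qed.

(** The defect is continuous and, by transversality, positive on the compact unit sphere of
    admissible [X]. Its minimum there is [s], and homogeneity does the rest. *)
Lemma transversal_defect {R : realType} n (G : rel 'I_n) m (A : 'M[R]_n) :
  transversal G m A ->
  exists2 s : R, 0 < s & forall X : 'M[R]_n, X^T = X -> nonedge_proj G X = X ->
    s * fnorm X <= defect m A A X.
Proof.
move=> tA.
pose S := [set X : 'M[R]_n | [/\ X^T = X, nonedge_proj G X = X & fnorm X = 1]].
have nS (X : 'M[R]_n) : X^T = X -> nonedge_proj G X = X -> X != 0 ->
    S ((fnorm X)^-1 *: X).
  move=> sX GX X0; split; rewrite ?linearZ /= ?sX ?nonedge_projZ ?GX //.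
  by rewrite fnormZ ger0_norm ?invr_ge0 ?fnorm_ge0 // mulVf // fnorm_eq0.
have cS : compact S.
  apply: (@compact_mx _ _ _ 1) => [M [_ _ ->] //|].
  have cid := @entrywise_continuous_id R n n.
  have -> : S = [set X | X^T - X = 0] `&` [set X | nonedge_proj G X - X = 0] `&`
      (fun X => fnorm X) @^-1` [set 1].
    apply/seteqP; split => X /=; first by move=> [-> -> ->]; rewrite !subrr.
    by move=> [[/eqP + /eqP]]; rewrite !subr_eq0 => /eqP ? /eqP.
  apply: closedI; first apply: closedI.
  - apply: closed_eq0; apply: entrywise_continuousB => //.
    exact: entrywise_continuous_tr.
  - apply: closed_eq0; apply: entrywise_continuousB => //.
    exact: entrywise_continuous_nonedge_proj.
  - apply: preimage_closed => [x _|]; last exact: closed_eq.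
    exact: (continuous_fnorm cid).
(* If the sphere is empty, 0 is the only admissible [X] and any positive constant will do. *)
have [S0|S0] := pselect (S !=set0); last first.
  exists 1 => // X sX GX; have [->|X0] := eqVneq X 0.
    by rewrite fnorm0 mulr0 defect_ge0.
  by case: S0; exists ((fnorm X)^-1 *: X); exact: nS.
have [Y [sY GY Y1] Ymin] := compact_attains_min cS (@continuous_defect R n m A) S0.
have dY : 0 < defect m A A Y.
  rewrite lt_def defect_ge0 andbT; apply/eqP => dY0.
  suff Y0 : Y = 0 by move: Y1; rewrite Y0 fnorm0 => /eqP; rewrite eq_sym oner_eq0.
  move/eqP: dY0; rewrite paddr_eq0 ?fnorm_ge0 ?sumr_ge0 // fnorm_eq0 => /andP[/eqP bY].
  rewrite psumr_eq0 // => /allP trY; apply: tA => // k.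
  by apply/eqP; rewrite -normr_eq0; apply: trY; rewrite mem_index_enum.
exists (defect m A A Y) => // X sX GX; have [->|X0] := eqVneq X 0.
  by rewrite fnorm0 mulr0 defect_ge0.
have Xp : 0 < fnorm X by rewrite lt_def fnorm_ge0 fnorm_eq0 X0.
have := Ymin _ (nS _ sX GX X0).
by rewrite defectZ ger0_norm ?invr_ge0 ?fnorm_ge0 // ler_pdivlMl // mulrC.
Qed.

Lemma exprmx_lipschitz {R : realType} n (A : 'M[R]_n) k :
  exists C : R, 0 <= C /\ forall L : 'M[R]_n, fnorm (L - A) <= 1 ->
    fnorm (L ^+ k - A ^+ k) <= C * fnorm (L - A).
Proof.
elim: k => [|k [C [C0 IH]]].
  by exists 0; split => // L _; rewrite !expr0 subrr fnorm0 mul0r.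
exists (fnorm (A ^+ k) + C + fnorm A * C); split.
  by rewrite !addr_ge0 ?mulr_ge0 ?fnorm_ge0.
move=> L LA; have -> : L ^+ k.+1 - A ^+ k.+1 =
    (L - A) *m L ^+ k + A *m (L ^+ k - A ^+ k).
  by rewrite !expmxS mulmxBl mulmxBr addrA subrK.
have Lk : fnorm (L ^+ k) <= fnorm (A ^+ k) + C.
  rewrite -[L ^+ k](subrK (A ^+ k)) addrC; apply: le_trans (fnormD _ _) _.
  by rewrite lerD2l; apply: le_trans (IH _ LA) _; rewrite ler_piMr.
apply: le_trans (fnormD _ _) _; rewrite mulrDl lerD //.
  by apply: le_trans (fnormM _ _) _; rewrite mulrC ler_wpM2r ?fnorm_ge0.
apply: le_trans (fnormM _ _) _; rewrite -mulrA ler_wpM2l ?fnorm_ge0 //.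
exact: IH.
Qed.

Lemma exprmx_lipschitz_uniform {R : realType} n (A : 'M[R]_n) m :
  exists C : R, 0 <= C /\ forall (k : 'I_m) (L : 'M[R]_n), fnorm (L - A) <= 1 ->
    fnorm (L ^+ k - A ^+ k) <= C * fnorm (L - A).
Proof.
have [c cP] := choice (fun k : 'I_m => exprmx_lipschitz A k).
have c0 k : 0 <= c k by case: (cP k).
exists (\sum_k c k); split; first exact: sumr_ge0.
move=> k L LA; have [_ /(_ _ LA)] := cP k; move=> h; apply: le_trans h _.
rewrite ler_wpM2r ?fnorm_ge0 // (bigD1 k) //= lerDl; exact: sumr_ge0.
Qed.

(** Half of the constant at [A] survives nearby. The bound serves twice: to exclude a nonzero
    projection at a minimiser, and to show that the property persists at the new matrix. *)
Lemma transversal_open {R : realType} n (G : rel 'I_n) m (A : 'M[R]_n) :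
  transversal G m A ->
  exists r s : R, [/\ 0 < r, 0 < s & forall N L X : 'M[R]_n,
    fnorm (N - A) <= r -> fnorm (L - A) <= r ->
    X^T = X -> nonedge_proj G X = X -> s * fnorm X <= defect m N L X].
Proof.
move=> /transversal_defect [s s0 sP].
have [C [C0 CP]] := exprmx_lipschitz_uniform A m.
(* Replacing [A] by [N] in the bracket costs [2 r |X|], and by [L] in the [m] traces at most
   [m C r |X|]; the radius below makes [c r <= s / 2]. *)
pose c := 2 + m%:R * C.
have c0 : 0 < c by rewrite ltr_pwDl // mulr_ge0 // ler0n.
exists (Num.min 1 (s / (2 * c))), (s / 2).
have r0 : 0 < Num.min 1 (s / (2 * c)).
  by rewrite lt_min ltr01 divr_gt0 // mulr_gt0.
split => //; first by rewrite divr_gt0.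
set r := Num.min _ _ in r0 *.
have r1 : r <= 1 by rewrite ge_min lexx.
have rs : r * (2 * c) <= s by rewrite -ler_pdivlMr ?mulr_gt0 // ge_min lexx orbT.
move=> N L X NA LA sX GX.
have HA := sP X sX GX.
have bAX : fnorm (bracket A X) <= fnorm (bracket N X) + 2 * (r * fnorm X).
  have -> : A = N + - (N - A) by rewrite opprB addrC subrK.
  rewrite bracketDl bracketNl; apply: le_trans (fnormB _ _) _.
  rewrite lerD2l; apply: le_trans (fnorm_bracket _ _) _.
  by rewrite ler_wpM2l // ler_wpM2r ?fnorm_ge0.
have tAX : \sum_(k < m) `|\tr (A ^+ k *m X)| <=
    \sum_(k < m) `|\tr (L ^+ k *m X)| + m%:R * (C * r * fnorm X).
  rewrite -[m in m%:R]card_ord -sum1_card natr_sum mulr_suml -big_split /=.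
  apply: ler_sum => k _; rewrite mul1r.
  have -> : A ^+ k = L ^+ k - (L ^+ k - A ^+ k) by rewrite opprB addrC subrK.
  rewrite mulmxBl raddfB /=; apply: le_trans (ler_normB _ _) _; rewrite lerD2l.
  apply: le_trans (trM_le _ _) _; rewrite ler_wpM2r ?fnorm_ge0 //.
  by apply: le_trans (CP k L (le_trans LA r1)) _; rewrite ler_wpM2l.
have : r * (2 * c) * fnorm X <= s * fnorm X by rewrite ler_wpM2r ?fnorm_ge0.
move: HA bAX tAX; rewrite /defect /c; lra.
Qed.

Lemma perturb_conj {R : realType} n m (a : 'rV[R]_m) (Q L : 'M[R]_n) :
  orthogonal_mx Q -> perturb a (Q *m L *m Q^T) = Q *m perturb a L *m Q^T.
Proof.
move=> QQ; rewrite /perturb mulmxDr mulmxDl; congr (_ + _).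
rewrite mulmx_sumr mulmx_suml; apply: eq_bigr => k _.
rewrite -scalemxAr -scalemxAl; congr (_ *: _).
elim: (k : nat) => [|j IH]; first by rewrite !expr0 mulmx1 QQ.
by rewrite !expmxS IH !mulmxA -(mulmxA _ Q^T) (mulmx1C QQ) mulmx1.
Qed.

Lemma perturb_near {R : realType} n m (A : 'M[R]_n) :
  exists C : R, 0 <= C /\ forall (a : 'rV[R]_m) (L : 'M[R]_n),
    fnorm (L - A) <= 1 -> fnorm (perturb a L - L) <= C * fnorm a.
Proof.
have [C [C0 CP]] := exprmx_lipschitz_uniform A m.
have C'0 (k : 'I_m) : 0 <= C + fnorm (A ^+ k) by rewrite addr_ge0 ?fnorm_ge0.
exists (\sum_(k < m) (C + fnorm (A ^+ k))); split; first exact: sumr_ge0.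
move=> a L LA; rewrite /perturb addrC addKr.
apply: le_trans (fnorm_sum _ _) _; rewrite mulr_suml.
apply: ler_sum => k _; rewrite fnormZ mulrC.
apply: ler_pM; rewrite ?fnorm_ge0 ?normr_ge0 ?entry_le_fnorm //.
rewrite -[L ^+ k](subrK (A ^+ k)); apply: le_trans (fnormD _ _) _.
by rewrite lerD2r; apply: le_trans (CP k L LA) _; rewrite ler_piMr.
Qed.

(* Squaring a norm avoids differentiating it:
   [2 |X| |X + W| <= |X|^2 + |X + W|^2 = 2 |X|^2 + 2 <X, W> + |W|^2]. *)
Lemma first_order_penalty {R : realType} n (G : rel 'I_n) (N V : 'M[R]_n) (p C : R) :
  let X := nonedge_proj G N in
  (forall t : R, 0 < t <= 1 -> exists2 N' : 'M[R]_n,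
     fnorm (N' - N - t *: V) <= C * t ^+ 2 &
     fnorm X <= fnorm (nonedge_proj G N') + t * p + C * t ^+ 2) ->
  - dotm X V <= p * fnorm X.
Proof.
move=> X H; rewrite -subr_ge0 opprK -(pmulr_rge0 _ (ltr0n R 2)).
set u := fnorm X in H *.
(* The first term is the quadratic part of [|X + W|^2]. The second collects two errors [C t ^+ 2],
   one from [NN] and one from [uN], each multiplied by [2 u]. *)
apply: (@first_order_ge0 _ _ (fnorm (nonedge_proj G V) ^+ 2 + 4 * u * C)) => t t01.
have /andP[t0 t1] := t01.
have [N' NN uN] := H t t01.
set E := N' - N - t *: V in NN.
have N'E : nonedge_proj G N' = X + t *: nonedge_proj G V + nonedge_proj G E.
  rewrite -nonedge_projZ -!nonedge_projD; congr nonedge_proj.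
  by rewrite /E -[X in _ + X]addrA -opprD [RHS]addrC subrK.
set W := t *: nonedge_proj G V in N'E.
have nE := fnorm_nonedge_proj G E.
have nN' : fnorm (nonedge_proj G N') <= fnorm (X + W) + C * t ^+ 2.
  by rewrite N'E; apply: le_trans (fnormD _ _) _; rewrite lerD2l; apply: le_trans nE _.
have u0 : 0 <= u by exact: fnorm_ge0.
have XW : fnorm (X + W) ^+ 2 = u ^+ 2 + 2 * t * dotm X V + t ^+ 2 * fnorm (nonedge_proj G V) ^+ 2.
  rewrite /u !sqr_fnorm !(dotmDl, dotmDr) (dotmC W X) /W !(dotmZl, dotmZr).
  rewrite /X (dotm_nonedge_proj G N V); ring.
have sq := sqr_ge0 (fnorm (X + W) - u).
have : u * u <= u * (fnorm (X + W) + t * p + 2 * C * t ^+ 2).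
  by rewrite ler_wpM2l //; lra.
lra.
Qed.

Lemma fnorm_delta_mx {R : realType} m n i j :
  fnorm (delta_mx i j : 'M[R]_(m, n)) = 1.
Proof.
rewrite /fnorm /dotm trmx_delta mul_delta_mx /mxtrace (bigD1 j) //= big1.
  by rewrite addr0 mxE !eqxx sqrtr1.
by move=> k kj; rewrite mxE (negbTE kj).
Qed.

Lemma perturb_delta {R : realType} n m (a : 'rV[R]_m) (s : R) k (L : 'M[R]_n) :
  perturb (a + s *: delta_mx 0 k) L = perturb a L + s *: L ^+ k.
Proof.
rewrite /perturb -addrA; congr (_ + _).
rewrite (bigD1 k) //= [in RHS](bigD1 k) //= addrAC !mxE !eqxx mulr1 scalerDl.
congr (_ + _); apply: eq_bigr => j jk.
by rewrite !mxE eqxx (negbTE jk) mulr0 addr0.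
Qed.

Lemma entrywise_continuous_perturb {R : realType} {T : topologicalType} n m
    (a : T -> 'rV[R]_m) (L : T -> 'M[R]_n) :
  entrywise_continuous a -> entrywise_continuous L ->
  entrywise_continuous (fun x => perturb (a x) (L x)).
Proof.
move=> ca cL; apply: entrywise_continuousD => //.
apply: entrywise_continuous_sum => k; apply: entrywise_continuousZ; first exact: ca.
exact: entrywise_continuousX.
Qed.

(** The norms are not squared, which makes the penalty exact: the slope of the first term does not
    fade as the projection shrinks, so a small [c] cannot stop it short of 0. *)
Definition penalised_cost {R : realType} {n m} (G : rel 'I_n) (M : 'M[R]_n)
    (c : R) (Q : 'M[R]_n) (a : 'rV[R]_m) : R :=
  fnorm (nonedge_proj G (perturb a (Q *m M *m Q^T))) +
  c * (fnorm (Q *m M *m Q^T - M) + fnorm a).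

Definition penalised_minimum {R : realType} {n m} (G : rel 'I_n) (M : 'M[R]_n)
    (c : R) (Q : 'M[R]_n) (a : 'rV[R]_m) :=
  forall (Q' : 'M[R]_n) (a' : 'rV[R]_m), orthogonal_mx Q' -> fnorm a' <= 1 ->
    penalised_cost G M c Q a <= penalised_cost G M c Q' a'.

(** The bound on [a] makes the domain compact. Minimisers considered later satisfy
    [fnorm a <= 1 / 2], so that this constraint is not active there. *)
Lemma penalised_minimum_exists {R : realType} n (G : rel 'I_n) m (M : 'M[R]_n) (c : R) :
  exists Q (a : 'rV[R]_m),
    [/\ orthogonal_mx Q, fnorm a <= 1 & penalised_minimum G M c Q a].
Proof.
pose S := @orthogonal_mx R n `*` [set a : 'rV[R]_m | fnorm a <= 1].
have cS : compact S.
  apply: compact_setX; first exact: compact_orthogonal_mx.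
  apply: (@compact_mx _ _ _ 1) => //.
  have -> : [set a : 'rV[R]_m | fnorm a <= 1] = (fun a => fnorm a) @^-1` [set x | x <= 1].
    by [].
  apply: preimage_closed => [x _|]; last exact: closed_le.
  exact: (continuous_fnorm (@entrywise_continuous_id R 1 m)).
have cQ : entrywise_continuous (fun x : 'M[R]_n * 'rV[R]_m => x.1).
  move=> i j x; apply: (@continuous_comp _ _ _ fst (fun Q : 'M[R]_n => Q i j)).
    exact: cvg_fst.
  exact: coord_continuous.
have ca : entrywise_continuous (fun x : 'M[R]_n * 'rV[R]_m => x.2).
  move=> i j x; apply: (@continuous_comp _ _ _ snd (fun a : 'rV[R]_m => a i j)).
    exact: cvg_snd.
  exact: coord_continuous.
have cL : entrywise_continuous (fun x : 'M[R]_n * 'rV[R]_m => x.1 *m M *m x.1^T).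
  apply: entrywise_continuousM; last exact: entrywise_continuous_tr.
  apply: entrywise_continuousM => //; exact: entrywise_continuous_cst.
have [] := @compact_attains_min R _ S (fun x => penalised_cost G M c x.1 x.2) cS.
- move=> x.
  apply: (@continuousD _ _ _ (fun x : 'M[R]_n * 'rV[R]_m =>
     fnorm (nonedge_proj G (perturb x.2 (x.1 *m M *m x.1^T))))).
    apply: continuous_fnorm; apply: entrywise_continuous_nonedge_proj.
    exact: entrywise_continuous_perturb.
  apply: (@continuousM _ _ (fun _ => c)); first exact: cst_continuous.
  apply: (@continuousD _ _ _ (fun x : 'M[R]_n * 'rV[R]_m =>
     fnorm (x.1 *m M *m x.1^T - M))); last exact: continuous_fnorm ca _.
  apply: continuous_fnorm; apply: entrywise_continuousB => //.
  exact: entrywise_continuous_cst.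
- exists (1%:M, 0); split => /=; first by rewrite /orthogonal_mx /= trmx1 mulmx1.
  by rewrite fnorm0.
move=> [Q a] [/= QQ a1] min; exists Q, a; split => // Q' a' Q'Q' a'1.
exact: (min (Q', a')).
Qed.

(** A Cayley rotation along [K] with [a] fixed moves [N] by [2t [N, K]] to first order, and raises
    the penalty on [L - M] by at most [2 c t |[L, K]|] to first order. *)
Lemma penalised_minimum_rotation {R : realType} n (G : rel 'I_n) m
    (M K Q : 'M[R]_n) (c : R) (a : 'rV[R]_m) :
  0 < c -> K^T = - K -> orthogonal_mx Q -> fnorm a <= 1 ->
  penalised_minimum G M c Q a ->
  let L := Q *m M *m Q^T in let N := perturb a L in let X := nonedge_proj G N in
  (- dotm X (2 *: bracket N K) <= 2 * c * fnorm (bracket L K) * fnorm X : Prop).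
Proof.
move=> c0 sK QQ a1 Qmin L N X.
set k := 4 * (2 * fnorm K + fnorm K ^+ 2) ^+ 2.
have k0 : 0 <= k by rewrite mulr_ge0 ?sqr_ge0.
apply: (@first_order_penalty _ _ _ _ _ _ (k * fnorm N + c * (k * fnorm L))).
rewrite -/X => t /andP[t0 t1].
have [|P PP PE] := @orthogonal_near_id _ _ _ t sK; first by rewrite (ltW t0).
have kt v : 0 <= v -> 0 <= k * v * t ^+ 2 
  by move=> v0; apply: mulr_ge0; [exact: mulr_ge0|exact: sqr_ge0].
exists (P *m N *m P^T).
  rewrite scalerA (mulrC t); apply: le_trans (PE N) _.
  rewrite -/k mulrDl lerDl -mulrA mulr_ge0 ?(ltW c0) //; exact/kt/fnorm_ge0.
have PQ : orthogonal_mx (P *m Q).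
  by rewrite /orthogonal_mx /= trmx_mul mulmxA -(mulmxA P) QQ mulmx1.
have := Qmin _ a PQ a1; rewrite /penalised_cost -/L -/N -/X trmx_mul.
have -> : P *m Q *m M *m (Q^T *m P^T) = P *m L *m P^T by rewrite /L !mulmxA.
(* Rotating [L] rotates the whole of [N], because a polynomial in a matrix commutes with orthogonal
   conjugation. *)
rewrite perturb_conj // -/N.
have PLM : fnorm (P *m L *m P^T - M) <= fnorm (L - M) +
    (2 * t * fnorm (bracket L K) + k * fnorm L * t ^+ 2).
  have PLE := PE L; set E := _ - _ in PLE.
  have -> : P *m L *m P^T - M = (L - M) + ((2 * t) *: bracket L K + E).
    have tele (x y z w : 'M[R]_n) : x - y = z - y + (w + (x - z - w)).
      by rewrite (addrC w) subrK [RHS]addrC addrA subrK.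
    exact: tele.
  apply: le_trans (fnormD _ _) _; rewrite lerD2l.
  apply: le_trans (fnormD _ _) _; rewrite fnormZ ger0_norm; last lra.
  by rewrite lerD2l.
have kN := kt _ (fnorm_ge0 N).
have := ler_wpM2l (ltW c0) PLM; lra.
Qed.

(** Moving one coefficient shifts [N] exactly along [L ^+ k] and raises the penalty by at most [c]
    times the shift. Using both signs gives the absolute value. *)
Lemma penalised_minimum_coefficient {R : realType} n (G : rel 'I_n) m
    (M Q : 'M[R]_n) (c : R) (a : 'rV[R]_m) (k : 'I_m) :
  0 < c -> orthogonal_mx Q -> fnorm a <= 1 / 2 -> penalised_minimum G M c Q a ->
  let L := Q *m M *m Q^T in let X := nonedge_proj G (perturb a L) in
  (`|dotm X (L ^+ k)| <= c * fnorm X : Prop).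
Proof.
move=> c0 QQ a2 Qmin L X; set N := perturb a L in X *.
(* The step [t / 2] with [t <= 1], added to [fnorm a <= 1 / 2], stays in the unit ball. *)
have half (z : R) : `|z| = 1 -> - dotm X ((z / 2) *: L ^+ k) <= (c / 2) * fnorm X.
  move=> z1; apply: (@first_order_penalty _ _ _ _ _ _ 0).
  rewrite -/X => t /andP[t0 t1].
  exists (perturb (a + (t * (z / 2)) *: delta_mx 0 k) L).
    by rewrite perturb_delta -/N scalerA [N + _]addrC addrK subrr fnorm0 mul0r.
  have nD : fnorm ((t * (z / 2)) *: (delta_mx 0 k : 'rV[R]_m)) = t / 2.
    by rewrite fnormZ fnorm_delta_mx mulr1 !normrM z1 mul1r (gtr0_norm t0) gtr0_norm ?invr_gt0.
  have nE : fnorm (a + (t * (z / 2)) *: delta_mx 0 k) <= fnorm a + t / 2.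
    by rewrite -nD fnormD.
  have := Qmin Q (a + (t * (z / 2)) *: delta_mx 0 k) QQ; rewrite /penalised_cost -/L -/N -/X.
  have le1 : fnorm (a + (t * (z / 2)) *: delta_mx 0 k) <= 1 by lra.
  move=> /(_ le1); have := ler_wpM2l (ltW c0) nE; lra.
have h1 := half 1 (normr1 _); have hN1 := half (- 1) (normrN1 _).
move: h1 hN1; rewrite !dotmZr => h1 hN1; rewrite ler_norml; lra.
Qed.

(* At a penalised minimiser with [nonedge_proj G N <> 0] every direction in the
   orbit would have slope at most of the order of [c], whereas transversality
   provides a direction of slope bounded away from [0]. *)
Lemma deform_into_pattern {R : realType} n (G : rel 'I_n) m (A : 'M[R]_n) (e : R) :
  (forall i j, G i j = G j i) -> A^T = A -> nonedge_proj G A = 0 ->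
  transversal G m A -> 0 < e ->
  exists2 d : R, 0 < d & forall M : 'M[R]_n, M^T = M -> fnorm (M - A) <= d ->
    exists Q (a : 'rV[R]_m), let L := Q *m M *m Q^T in
      [/\ orthogonal_mx Q, fnorm a <= e, fnorm (L - A) <= e,
          fnorm (perturb a L - A) <= e & nonedge_proj G (perturb a L) = 0].
Proof.
move=> sG sA GA tA e0.
have [r [s [r0 s0 rs]]] := transversal_open tA.
have [C [C0 CP]] := perturb_near m A.
pose B := fnorm A + 1.
have B0 : 0 < B by rewrite ltr_wpDl ?fnorm_ge0.
have m0 : (0 : R) <= m%:R by exact: ler0n.
(* Below, [2 B c |X|] bounds the bracket and [m c |X|] the sum of the traces; together they must
   stay under [s |X|]. *)
pose c := s / (2 * (2 * B + m%:R)).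
have c0 : 0 < c by rewrite divr_gt0 // mulr_gt0 // ltr_wpDr // mulr_gt0.
have cs : (2 * B + m%:R) * c < s.
  have : c * (2 * (2 * B + m%:R)) = s.
    by rewrite divfK // gt_eqF // mulr_gt0 // ltr_wpDr // mulr_gt0.
  lra.
(* [h] will bound [|L - M| + |a|]. Then [N - L], [L - M] and [M - A] contribute [h C], [h] and [h]
   to the distance from [N] to [A]. *)
pose h := Num.min (1 / 2) (Num.min e r / (C + 2)).
have C2 : 0 < C + 2 by rewrite ltr_wpDl.
have h0 : 0 < h by rewrite !lt_min divr_gt0 // divr_gt0 // lt_min e0.
have h2 : h <= 1 / 2 by rewrite ge_min lexx.
have her : h * (C + 2) <= Num.min e r by rewrite -ler_pdivlMr // ge_min lexx orbT.
have [hE hr] : h * (C + 2) <= e /\ h * (C + 2) <= r.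
  by split; apply: le_trans her _; rewrite ge_min lexx ?orbT.
have hC : 0 <= h * C by rewrite mulr_ge0 // ltW.
pose d := Num.min h (c * h).
have d0 : 0 < d by rewrite lt_min h0 mulr_gt0.
have dh : d <= h by rewrite ge_min lexx.
have dch : d <= c * h by rewrite ge_min lexx orbT.
exists d => // M sM MA.
have [Q [a [QQ a1 Qmin]]] := penalised_minimum_exists G m M c.
set L := Q *m M *m Q^T; set N := perturb a L; set X := nonedge_proj G N.
have sL : L^T = L by rewrite /L !trmx_mul trmxK sM mulmxA.
have sLk k : (L ^+ k)^T = L ^+ k.
  elim: k => [|k IH]; first by rewrite expr0 trmx1.
  by rewrite expmxS trmx_mul IH sL -expmxS exprSr.
have sN : N^T = N.
  rewrite /N /perturb linearD /= sL linear_sum /=; congr (_ + _).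
  by apply: eq_bigr => k _; rewrite linearZ /= sLk.
have nL : fnorm L <= B.
  rewrite fnorm_conj // -[M](subrK A) addrC; apply: le_trans (fnormD _ _) _.
  by rewrite lerD2l; lra.
(* Comparison with [Q = 1], [a = 0], where the cost is the norm of the projection of [M - A], at
   most [d <= c h]. *)
have small : fnorm X + c * (fnorm (L - M) + fnorm a) <= c * h.
  apply: le_trans dch.
  have O1 : orthogonal_mx (1%:M : 'M[R]_n) by rewrite /orthogonal_mx /= trmx1 mulmx1.
  have := Qmin 1%:M 0 O1; rewrite /penalised_cost -/L -/N -/X fnorm0 ler01 => /(_ isT) H; apply: le_trans H _.
  rewrite trmx1 mulmx1 mul1mx subrr fnorm0 addr0 mulr0 addr0 /perturb.
  rewrite big1 ?addr0; last by move=> k _; rewrite mxE scale0r.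
  apply: le_trans MA; rewrite -[M in leLHS](subrK A) nonedge_projD GA addr0.
  exact: fnorm_nonedge_proj.
have X0 := fnorm_ge0 X.
have LMa : fnorm (L - M) + fnorm a <= h.
  by rewrite -(ler_pM2l c0); lra.
have [LM0 a0] := (fnorm_ge0 (L - M), fnorm_ge0 a).
have LA : fnorm (L - A) <= fnorm (L - M) + d.
  by rewrite -[L](subrK M) -addrA; apply: le_trans (fnormD _ _) _; rewrite addrK lerD2l.
have NL : fnorm (N - L) <= h * C.
  apply: le_trans (CP a L _) _; first lra.
  by rewrite mulrC ler_wpM2r //; lra.
have NA : fnorm (N - A) <= h * (C + 2).
  by rewrite -[N](subrK L) -addrA; apply: le_trans (fnormD _ _) _; lra.
exists Q, a; rewrite /= -/L -/N -/X; split => //.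
- by clear - LMa LM0 a0 hE hC h0; lra.
- by clear - LMa LM0 a0 LA dh hE hC h0; lra.
- exact: le_trans NA hE.
apply/eqP; rewrite -fnorm_eq0; apply/negP => /negP Xn0.
have Xp : 0 < fnorm X by rewrite lt_def Xn0 X0.
have sX : X^T = X by exact: tr_nonedge_proj.
pose Y := bracket N X.
have sY : Y^T = - Y by exact: tr_bracket.
have sYN : (- Y)^T = - - Y by rewrite linearN /= sY.
have rot := penalised_minimum_rotation c0 sYN QQ a1 Qmin.
have a2 : fnorm a <= 1 / 2 by clear - LMa LM0 h2; lra.
have coef (k : 'I_m) : `|\tr (L ^+ k *m X)| <= c * fnorm X.
  have := penalised_minimum_coefficient k c0 QQ a2 Qmin.
  by rewrite /= -/L -/N -/X [dotm X _]/dotm sX mxtrace_mulC.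
(* The rotation inequality along [- Y] reads [2 |Y|^2 <= 2 c |[L, Y]| |X|], and [|[L, Y]| <= 2 B
   |Y|]. *)
have Yb : fnorm Y <= 2 * B * c * fnorm X.
  have [->|Y0] := eqVneq (fnorm Y) 0.
    by rewrite mulr_ge0 // mulr_ge0 ?(ltW c0) // mulr_ge0 ?(ltW B0).
  have Yp : 0 < fnorm Y by rewrite lt_def Y0 fnorm_ge0.
  rewrite -(ler_pM2r Yp).
  have XY : - dotm X (2 *: bracket N (- Y)) = 2 * (fnorm Y * fnorm Y).
    rewrite dotmZr /dotm sX trM_bracket -expr2 sqr_fnorm /dotm.
    have -> : bracket X N = - Y by rewrite /Y /bracket opprB.
    by rewrite sY !mulNmx !mulmxN opprK !raddfN /= mulrN.
  have := fnorm_bracket L (- Y); rewrite fnormN => LY.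
  have LY' : fnorm (bracket L (- Y)) <= 2 * (B * fnorm Y).
    by apply: le_trans LY _; rewrite ler_wpM2l // ler_wpM2r // ltW.
  have := ler_wpM2r X0 (ler_wpM2l (ltW c0) LY').
  move: rot; rewrite /= -/L -/N -/X XY; clear; lra.
have : defect m N L X <= 2 * B * c * fnorm X + m%:R * (c * fnorm X).
  rewrite /defect lerD // -[m in m%:R]card_ord -sum1_card natr_sum mulr_suml.
  by apply: ler_sum => k _; rewrite mul1r.
have LAr : fnorm (L - A) <= r by clear - LMa LM0 a0 LA dh hr hC h0; lra.
have NAr : fnorm (N - A) <= r by exact: le_trans NA hr.
have GX : nonedge_proj G X = X by exact: nonedge_proj_id.
have := rs N L X NAr LAr sX GX.
have : (2 * B + m%:R) * c * fnorm X < s * fnorm X by rewrite ltr_pM2r.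
clear; lra.
Qed.

(** * Distinct eigenvalues *)

Definition distinct_entries {R : realType} {n} (d : 'rV[R]_n) : nat :=
  size (undup (codom (d 0))).

Lemma size_undup_eqi (T : eqType) (s t : seq T) :
  uniq t -> s =i t -> size (undup s) = size t.
Proof.
move=> ut st; apply/eqP; rewrite -uniq_size_uniq ?undup_uniq // => x.
by rewrite mem_undup st.
Qed.

Lemma char_poly_conj {R : realType} n (U A : 'M[R]_n) :
  orthogonal_mx U -> char_poly (U *m A *m U^T) = char_poly A.
Proof.
move=> UU; pose V := map_mx polyC U; pose V' := map_mx polyC U^T.
have VV : V *m V' = 1%:M by rewrite -map_mxM UU map_mx1.
rewrite /char_poly.
have -> : char_poly_mx (U *m A *m U^T) = V *m char_poly_mx A *m V'.
  rewrite /char_poly_mx !map_mxM mulmxBr mulmxBl scalar_mxC.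
  by rewrite -(mulmxA _ V) VV mulmx1.
by rewrite !det_mulmx mulrAC -det_mulmx VV det1 mul1r.
Qed.

Lemma size_rootsR_diag {R : realType} n (U : 'M[R]_n) (d : 'rV[R]_n) :
  orthogonal_mx U ->
  size (rootsR (char_poly (U *m diag_mx d *m U^T))) = distinct_entries d.
Proof.
move=> UU; rewrite char_poly_conj //; set p := char_poly _.
have pE : p = \prod_(x <- codom (d 0)) ('X - x%:P).
  rewrite /p char_poly_trig ?diag_mx_is_trig // big_image /=.
  by apply: eq_bigr => i _; rewrite mxE eqxx.
have p0 : p != 0 by rewrite monic_neq0 // char_poly_monic.
symmetry; apply: size_undup_eqi => [|x]; first exact: uniq_roots.
by rewrite -(roots_on_rootsR p0) /= pE root_prod_XsubC.
Qed.

(** Some value occurs at two positions; moving one of them to a nearby new value adds that value and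
    loses none. *)
Lemma distinct_entries_step {R : realType} n (d : 'rV[R]_n) (e : R) :
  0 < e -> (distinct_entries d < n)%N ->
  exists d' : 'rV[R]_n, (forall i, `|d' 0 i - d 0 i| <= e) /\
    distinct_entries d' = (distinct_entries d).+1.
Proof.
move=> e0 dn.
have /injectivePn [i [j ij dij]] : ~~ injectiveb (d 0).
  apply: contraL dn => di; rewrite -leqNgt /distinct_entries undup_id //.
  by rewrite size_codom card_ord.
(* Of [n + 1] distinct candidates within [e] of the repeated value, one differs from all [n]
   entries. *)
pose f (k : nat) := d 0 i + e / k.+1%:R.
have finj : injective f.
  move=> k l /addrI /(mulfI (lt0r_neq0 e0)) /invr_inj /eqP.
  by rewrite eqr_nat => /eqP [].
have [t td te] : exists2 t, t \notin codom (d 0) & `|t - d 0 i| <= e.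
  have : ~~ all (fun x => x \in codom (d 0)) (mkseq f n.+1).
    apply/negP => /allP /(uniq_leq_size _).
    by rewrite size_mkseq size_codom card_ord ltnn mkseq_uniq // => /(_ isT).
  rewrite -has_predC => /hasP [_ /mapP[k _ ->] fk]; exists (f k) => //.
  rewrite /f addrC addKr ger0_norm ?divr_ge0 ?ler0n ?(ltW e0) //.
  by rewrite ler_pdivrMr ?ltr0n // ler_peMr ?ler1n // ltW.
exists (\row_l if l == i then t else d 0 l); split.
  by move=> l; rewrite mxE; case: eqP => [->//|_]; rewrite subrr normr0 ltW.
rewrite /distinct_entries; apply: (@size_undup_eqi _ _ (t :: undup (codom (d 0)))).
  by rewrite /= mem_undup td undup_uniq.
move=> x; rewrite inE mem_undup; apply/codomP/orP => [[l]|[/eqP ->|/codomP[l ->]]].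
- rewrite mxE; case: eqP => [_ ->|_ ->]; first by left.
  by right; exact: codom_f.
- by exists i; rewrite mxE eqxx.
- have [->|li] := eqVneq l i; last by exists l; rewrite mxE (negbTE li).
  by exists j; rewrite mxE eq_sym (negbTE ij).
Qed.

Lemma distinct_entries_refine {R : realType} n (d : 'rV[R]_n) q :
  (distinct_entries d <= q <= n)%N -> forall e : R, 0 < e ->
  exists d' : 'rV[R]_n, (forall i, `|d' 0 i - d 0 i| <= e) /\
    distinct_entries d' = q.
Proof.
elim: q => [|q IH] /andP[dq qn] e e0.
  exists d; split; last by apply/eqP; rewrite -leqn0.
  by move=> i; rewrite subrr normr0 ltW.
move: dq; rewrite leq_eqVlt => /orP[/eqP dq|dq].
  by exists d; split => // i; rewrite subrr normr0 ltW.
have e2 : 0 < e / 2 by rewrite divr_gt0.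
have [|d1 [d1d d1q]] := IH _ _ e2; first by rewrite -ltnS dq ltnW.
have [|d2 [d2d d2q]] := distinct_entries_step (d := d1) e2; first by rewrite d1q.
exists d2; split; last by rewrite d2q d1q.
move=> i; rewrite -(subrKA (d1 0 i)); apply: le_trans (ler_normD _ _) _.
by have := d1d i; have := d2d i; lra.
Qed.

Definition perturbation_poly {R : realType} {m} (a : 'rV[R]_m) (x : R) : R :=
  x + \sum_(k < m) a 0 k * x ^+ k.

Lemma perturb_diag {R : realType} n m (a : 'rV[R]_m) (d : 'rV[R]_n) :
  perturb a (diag_mx d) = diag_mx (map_mx (perturbation_poly a) d).
Proof.
have dk k : (diag_mx d) ^+ k = diag_mx (\row_i d 0 i ^+ k).
  elim: k => [|k IH]; last first.
    rewrite expmxS IH mulmx_diag; congr diag_mx.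
    by apply/rowP => i; rewrite !mxE exprS.
  rewrite expr0 -[LHS]/(1%:M) -diag_const_mx; congr diag_mx.
  by apply/rowP => i; rewrite !mxE expr0.
rewrite /perturb; under eq_bigr do rewrite dk -linearZ.
rewrite -linear_sum -linearD; congr diag_mx; apply/rowP => i.
rewrite !mxE summxE /perturbation_poly; congr (_ + _).
by apply: eq_bigr => k _; rewrite !mxE.
Qed.

Lemma exprr_lipschitz {R : realType} (B : R) k : 0 <= B ->
  exists C : R, 0 <= C /\ forall x y, `|x| <= B -> `|y| <= B ->
    `|x ^+ k - y ^+ k| <= C * `|x - y|.
Proof.
move=> B0; elim: k => [|k [C [C0 IH]]].
  by exists 0; split => // x y _ _; rewrite !expr0 subrr normr0 mul0r.
exists (B ^+ k + B * C); split; first by rewrite addr_ge0 ?exprn_ge0 ?mulr_ge0.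
move=> x y xB yB; have -> : x ^+ k.+1 - y ^+ k.+1 =
    x ^+ k * (x - y) + y * (x ^+ k - y ^+ k) by rewrite !exprS; ring.
apply: le_trans (ler_normD _ _) _; rewrite mulrDl lerD //.
  by rewrite normrM ler_wpM2r // normrX lerXn2r ?nnegrE.
by rewrite normrM -mulrA ler_pM // IH.
Qed.

(** On [[-B, B]] the added polynomial has Lipschitz constant at most [|a| C < 1], too small to
    cancel the identity. *)
Lemma perturbation_poly_inj {R : realType} m (B : R) : 0 <= B ->
  exists2 e : R, 0 < e & forall (a : 'rV[R]_m), fnorm a <= e ->
    forall x y, `|x| <= B -> `|y| <= B ->
    perturbation_poly a x = perturbation_poly a y -> x = y.
Proof.
move=> B0; have [c cP] := choice (fun k : 'I_m => exprr_lipschitz k B0).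
have c0 k : 0 <= c k by case: (cP k).
pose C := \sum_k c k; have C0 : 0 <= C by exact: sumr_ge0.
have C1 : 0 < C + 1 by rewrite ltr_wpDl.
exists (1 / (C + 1)); first by rewrite divr_gt0.
move=> a; rewrite ler_pdivlMr // => aC x y xB yB pxy.
have xyE : x - y = \sum_k a 0 k * (y ^+ k - x ^+ k).
  have -> : \sum_k a 0 k * (y ^+ k - x ^+ k) =
      \sum_k a 0 k * y ^+ k - \sum_k a 0 k * x ^+ k.
    by rewrite -sumrB; apply: eq_bigr => k _; rewrite mulrBr.
  by move: pxy; rewrite /perturbation_poly => pxy; lra.
have : `|x - y| <= fnorm a * C * `|x - y|.
  rewrite {1}xyE; apply: le_trans (ler_norm_sum _ _ _) _.
  rewrite mulr_sumr mulr_suml; apply: ler_sum => k _.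
  rewrite normrM -mulrA ler_pM // ?entry_le_fnorm // distrC.
  by case: (cP k) => _; apply.
have a0 := fnorm_ge0 a; have xy0 := normr_ge0 (x - y).
move=> H; apply/eqP; rewrite -subr_eq0 -normr_le0.
have [//|xyp] := leP `|x - y| 0.
move: H; rewrite -{1}[`|x - y|]mul1r ler_pM2r // => H.
(* [1 <= |a| C] and [|a| (C + 1) <= 1] force [|a| = 0], which contradicts the former. *)
have a1 : fnorm a = 0 by lra.
by move: H; rewrite a1 mul0r ler10.
Qed.

Lemma distinct_entries_map {R : realType} n (d : 'rV[R]_n) (f : R -> R) :
  (forall i j, f (d 0 i) = f (d 0 j) -> d 0 i = d 0 j) ->
  distinct_entries (map_mx f d) = distinct_entries d.
Proof.
move=> finj; rewrite /distinct_entries.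
rewrite (@size_undup_eqi _ _ (map f (undup (codom (d 0))))) ?size_map //.
  rewrite map_inj_in_uniq ?undup_uniq // => x y; rewrite !mem_undup.
  by move=> /codomP[i ->] /codomP[j ->]; exact: finj.
move=> x; apply/codomP/mapP => [[i ->]|[y]].
  by exists (d 0 i); rewrite ?mxE // mem_undup codom_f.
by rewrite mem_undup => /codomP[i ->] ->; exists i; rewrite mxE.
Qed.

Lemma fnorm_diag_mx_le {R : realType} n (d : 'rV[R]_n) (e : R) :
  (forall i, `|d 0 i| <= e) -> fnorm (diag_mx d) <= n%:R * e.
Proof.
move=> de; rewrite diag_mx_sum_delta; apply: le_trans (fnorm_sum _ _) _.
rewrite -[n in n%:R]card_ord -sum1_card natr_sum mulr_suml.
by apply: ler_sum => i _; rewrite fnormZ fnorm_delta_mx mulr1 mul1r.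
Qed.

(** Provides the margin that keeps nonzero entries nonzero; the default 1 covers an identically zero
    [f]. *)
Lemma finite_gap {R : realType} (T : finType) (f : T -> R) :
  exists2 g : R, 0 < g & forall x, f x != 0 -> g <= `|f x|.
Proof.
exists (\big[Num.min/1]_(x | f x != 0) `|f x|).
  by apply: lt_bigmin => // x; rewrite normr_gt0.
by move=> x fx; exact: bigmin_le_cond.
Qed.

(** * Refining the spectrum *)

(** The off-diagonal support of [A] is exactly [G], so the two entrywise conditions confine [X] to
    the non-edges. *)
Lemma nonedge_proj_pattern (n : nat) (G : rel 'I_n) (A X : 'M[R]_n) :
  (forall i, G i i = false) -> in_SG G A ->
  nonedge_proj G X = X <->
  (forall i j, A i j * X i j = 0) /\ (forall i, X i i = 0).
Proof.
move=> Gii [_ GA]; split=> [GX|[AX Xii]].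
  split=> [i j|i]; rewrite -GX mxE ?eqxx //.
  case: ifP => [_|/norP[ij Gij]]; first by rewrite mulr0.
  have := GA i j ij; rewrite (negbTE Gij) => /negbFE/eqP ->; exact: mul0r.
apply/matrixP => i j; rewrite mxE; have [->|ij] /= := eqVneq i j; first by rewrite Xii.
case: ifP => // Gij; have /eqP := AX i j.
by rewrite mulf_eq0 => /orP[/eqP Aij|/eqP ->//]; move: Gij; rewrite -GA // Aij eqxx.
Qed.

Lemma bracket_eq0 {R : realType} n (A X : 'M[R]_n) :
  bracket A X = 0 <-> A *m X = X *m A.
Proof.
by rewrite /bracket; split => [/eqP|->]; [rewrite subr_eq0 => /eqP|rewrite subrr].
Qed.

Lemma SSP_transversal (n : nat) (G : rel 'I_n) (A : 'M[R]_n) :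
  (forall i, G i i = false) -> in_SG G A -> SSP A <-> transversal G 0 A.
Proof.
move=> Gii AG; split => H X sX.
  move=> /(nonedge_proj_pattern _ Gii AG) [AX Xii] /bracket_eq0 AXA _.
  exact: H.
move=> AX Xii /bracket_eq0 AXA; apply: H => //; last by case.
exact/(nonedge_proj_pattern _ Gii AG).
Qed.

Lemma SMP_transversal (n : nat) (G : rel 'I_n) (A : 'M[R]_n) :
  (forall i, G i i = false) -> in_SG G A -> SMP A <-> transversal G (qA A) A.
Proof.
move=> Gii AG; split => H X sX.
  move=> /(nonedge_proj_pattern _ Gii AG) [AX Xii] /bracket_eq0 AXA tr0.
  by apply: H => // k kq; exact: (tr0 (Ordinal kq)).
move=> AX Xii /bracket_eq0 AXA tr0; apply: H => //; last by move=> k; exact: tr0.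
exact/(nonedge_proj_pattern _ Gii AG).
Qed.

(** More trace conditions leave fewer competing [X]. This absorbs the growth of the number of
    eigenvalues in the SMP. *)
Lemma transversal_leq {R : realType} n (G : rel 'I_n) m m' (A : 'M[R]_n) :
  (m <= m')%N -> transversal G m A -> transversal G m' A.
Proof.
move=> mm' H X sX GX bX tr0; apply: H => // k.
exact: (tr0 (widen_ord mm' k)).
Qed.

Lemma transversal_refine (n : nat) (G : rel 'I_n) m (A : 'M[R]_n) :
  simple_graph G -> in_SG G A -> transversal G m A ->
  forall q', (qA A <= q' <= n)%N ->
  exists A' : 'M[R]_n, [/\ in_SG G A', transversal G m A' & qA A' = q'].
Proof.
move=> [sG Gii] AG tA q' q'q; have [sA GA] := AG.
have PA : nonedge_proj G A = 0.
  apply/matrixP => i j; rewrite !mxE; case: ifP => // /norP[ij Gij].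
  by have := GA i j ij; rewrite (negbTE Gij) => /negbFE/eqP.
have [U [d [UU AE]]] := symmetric_diagonalisation sA.
have B0 : 0 <= fnorm A + 1 by rewrite addr_ge0 ?fnorm_ge0.
have [r [s [r0 s0 rs]]] := transversal_open tA.
have [e1 e10 inj] := perturbation_poly_inj m B0.
have [g g0 gP] := finite_gap (fun ij : 'I_n * 'I_n => A ij.1 ij.2).
(* [r] preserves transversality, [e1] keeps distinct eigenvalues distinct, and [g / 2] keeps the
   edge entries nonzero. *)
pose e := Num.min r (Num.min e1 (g / 2)).
have e0 : 0 < e by rewrite !lt_min r0 e10 divr_gt0.
have [er ee1 eg] : [/\ e <= r, e <= e1 & e <= g / 2].
  by rewrite /e !ge_min !lexx !orbT.
have [dl dl0 dlP] := deform_into_pattern sG sA PA tA e0.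
(* A diagonal change of size [h] has norm at most [n h]; the successor avoids division by zero when
   [n = 0]. The bound 1 keeps the spectrum of [M] in the interval where [inj] applies. *)
pose h := Num.min dl 1 / n.+1%:R.
have h0 : 0 < h by rewrite divr_gt0 ?ltr0n // lt_min dl0 ltr01.
have [d' [d'd d'q]] : exists d' : 'rV[R]_n,
    (forall i, `|d' 0 i - d 0 i| <= h) /\ distinct_entries d' = q'.
  by apply: distinct_entries_refine => //; rewrite -(size_rootsR_diag _ UU) -AE.
pose M := U *m diag_mx d' *m U^T.
have MA : fnorm (M - A) <= Num.min dl 1.
  have -> : M - A = U *m diag_mx (d' - d) *m U^T.
    by rewrite AE /M [diag_mx (_ - _)]raddfB mulmxBr mulmxBl.
  rewrite fnorm_conj //; apply: le_trans (fnorm_diag_mx_le (e := h) _) _.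
    by move=> i; rewrite !mxE.
  rewrite /h mulrA ler_pdivrMr ?ltr0n // mulrC ler_wpM2l ?ler_nat //.
  by rewrite ltW // lt_min dl0 ltr01.
have [MAd MA1] : fnorm (M - A) <= dl /\ fnorm (M - A) <= 1.
  by split; apply: le_trans MA _; rewrite ge_min lexx ?orbT.
have sM : M^T = M by rewrite /M !trmx_mul trmxK tr_diag_mx mulmxA.
have [Q [a [QQ ae _ NA PN]]] := dlP M sM MAd.
have QU : orthogonal_mx (Q *m U).
  by rewrite /orthogonal_mx /= trmx_mul mulmxA -(mulmxA Q) UU mulmx1.
set N := perturb a _ in NA PN.
have NE : N = (Q *m U) *m diag_mx (map_mx (perturbation_poly a) d') *m (Q *m U)^T.
  by rewrite -perturb_diag -perturb_conj // /N /M trmx_mul !mulmxA.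
have sN : N^T = N by rewrite NE !trmx_mul !trmxK tr_diag_mx !mulmxA.
have d'B i : `|d' 0 i| <= fnorm A + 1.
  have := entry_le_fnorm (diag_mx d') i i; rewrite mxE eqxx => h1.
  apply: le_trans h1 _; rewrite -(fnorm_conj (diag_mx d') UU) -/M.
  rewrite -[M](subrK A) addrC; apply: le_trans (fnormD _ _) _.
  by rewrite lerD2l.
have NAr := le_trans NA er.
exists N; split.
- split=> // i j ij; case Gij: (G i j).
    have Aij : A i j != 0 by rewrite GA.
    have := gP (i, j) Aij; have := entry_le_fnorm (N - A) i j; rewrite !mxE /= => h1 h2.
    apply/eqP => N0; move: h1; rewrite N0 sub0r normrN; lra.
  apply/negbTE; rewrite negbK; have /matrixP/(_ i j) := PN.
  by rewrite [LHS]mxE (negbTE ij) Gij /= => ->; rewrite mxE.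
(* All the conditions make the defect at [N] vanish, so [s |X| <= 0]. *)
- move=> X sX GX bX tr0; have := rs N N X NAr NAr sX GX.
  rewrite /defect bX fnorm0 big1 ?addr0 => [|k _]; last by rewrite tr0 normr0.
  by rewrite pmulr_rle0 // => X0; apply/eqP; rewrite -fnorm_eq0 eq_le X0 fnorm_ge0.
- rewrite /qA NE size_rootsR_diag // distinct_entries_map // => i j.
  by apply: inj => //; exact: le_trans ae ee1.
Qed.

Theorem theorem4p1 (n : nat) (G : rel 'I_n) (A : 'M[R]_n) :
  simple_graph G -> in_SG G A ->
  (SSP A -> forall q' : nat, (qA A <= q' <= n)%N ->
     exists A' : 'M[R]_n, [/\ in_SG G A', SSP A' & qA A' = q'])
  /\
  (SMP A -> forall q' : nat, (qA A <= q' <= n)%N ->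
     exists A' : 'M[R]_n, [/\ in_SG G A', SMP A' & qA A' = q']).
Proof.
move=> gG AG; have [_ Gii] := gG; split => HA q' q'q.
  have /(SSP_transversal Gii AG) tA := HA.
  have [A' [A'G tA' A'q]] := transversal_refine gG AG tA q'q.
  by exists A'; split => //; apply/(SSP_transversal Gii A'G).
have /(SMP_transversal Gii AG) tA := HA.
have [A' [A'G tA' A'q]] := transversal_refine gG AG tA q'q.
exists A'; split => //; apply/(SMP_transversal Gii A'G).
(* [A'] inherits transversality with [qA A] traces, whereas its SMP allows [q' >= qA A] of them. *)
by apply: transversal_leq tA'; rewrite A'q; case/andP: q'q.
Qed.
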